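(* Let $A$ be a unital $C^*$-algebra with essential socle. Then $F_1(A)$ is exactly the set of minimal elements of $A\setminus\{0\}$ with respect to the diamond partial order $\leq_\diamond$.
   Context: All algebras are complex. For elements $a,b$ of a unital $C^*$-algebra $A$, the diamond relation is defined by: $a\leq_\diamond b$ if and only if $aA\subseteq bA$, $Aa\subseteq Ab$ and $aa^*a=ab^*a$; it is a partial order on $A$. $F_1(A)$ denotes the set of rank-one elements of $A$, i.e. the nonzero elements $u\in A$ that belong to some minimal left (equivalently, right) ideal of $A$; equivalently, $u\neq 0$ and $uAu=\mathbb{C}u$. The socle $\mathrm{Soc}(A)$ is the sum of all minimal left ideals (equivalently, of all minimal right ideals) of $A$. A nonzero ideal $I$ of $A$ is essential if it has nonzero intersection with every nonzero ideal of $A$; equivalently (for $C^*$-algebras), for $a\in A$, $aI=0$ implies $a=0$. ''$A$ has essential socle'' means $\mathrm{Soc}(A)$ is an essential ideal. *)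

(* Defs.v *)
From HB Require Import structures.
From mathcomp Require Import all_boot all_order all_algebra.
From mathcomp Require Import complex.
From mathcomp Require Import boolp classical_sets reals topology normedtype.

Set Implicit Arguments.
Unset Strict Implicit.
Unset Printing Implicit Defensive.

Import Order.TTheory GRing.Theory Num.Theory.
Import numFieldNormedType.Exports.

Local Open Scope classical_set_scope.
Local Open Scope ring_scope.

(* The carrier cannot also be a library normed module: Hierarchy-Builder does
   not accept a new structure inheriting from both GRing.PzSemiRing and
   Num.SemiNormedZmodule, whose declared join is Num.NumDomain. Hence the
   R-valued norm and its completeness are spelled out. *)
HB.mixin Record Algebra_isCStar (R : realType) A & GRing.Algebra R[i] A := {
  star : A -> A ;
  cnorm : A -> R ;
  starK : involutive star ;
  starD : {morph star : a b / a + b} ;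
  starZ : forall (k : R[i]) (a : A), star (k *: a) = conjc k *: star a ;
  starM : forall a b : A, star (a * b) = star b * star a ;
  cnorm0_eq0 : forall a : A, cnorm a = 0 -> a = 0 ;
  cnormD : forall a b : A, cnorm (a + b) <= cnorm a + cnorm b ;
  cnormZ : forall (k : R[i]) (a : A),
    cnorm (k *: a) = ComplexField.Normc.normc k * cnorm a ;
  cnormM : forall a b : A, cnorm (a * b) <= cnorm a * cnorm b ;
  cnorm_complete : forall s : nat -> A,
    (forall e : R, 0 < e -> exists N : nat, forall m n : nat,
       (N <= m)%N -> (N <= n)%N -> cnorm (s m - s n) < e) ->
    exists l : A, cnorm (s n - l) @[n --> \oo] --> (0 : R) ;
  cnorm_star : forall a : A, cnorm (star a * a) = cnorm a ^+ 2 }.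

(* GRing.Algebra imposes 1 != 0: the zero algebra, whose socle is zero and
   hence never essential, is excluded. *)
#[short(type="unitalCStarAlgType")]
HB.structure Definition UnitalCStarAlg (R : realType) :=
  {A of GRing.Algebra R[i] A & Algebra_isCStar R A}.

Section AlgebraNotions.
Context {R : realType} {A : unitalCStarAlgType R}.
Implicit Types (a b u x : A) (I J L : set A).

Definition diamond_le a b : Prop :=
  [/\ range (fun x => a * x) `<=` range (fun x => b * x),
      range (fun x => x * a) `<=` range (fun x => x * b)
    & a * star a * a = a * star b * a].

(* Since A is unital, stability under multiplication by elements of A implies
   stability under scalars. *)
Definition left_ideal L : Prop :=
  [/\ L 0, forall x y, L x -> L y -> L (x + y)
    & forall a x, L x -> L (a * x)].

Definition ideal I : Prop :=
  left_ideal I /\ forall a x, I x -> I (x * a).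

Definition minimal_left_ideal L : Prop :=
  [/\ left_ideal L, L <> [set 0]
    & forall J, left_ideal J -> J `<=` L -> J = [set 0] \/ J = L].

Definition rank_one : set A :=
  [set u | u <> 0 /\ exists2 L, minimal_left_ideal L & L u].

Definition socle : set A :=
  [set x | exists (n : nat) (f : 'I_n -> A),
     (forall i, exists2 L, minimal_left_ideal L & L (f i))
     /\ x = \sum_(i < n) f i].

Definition essential_ideal I : Prop :=
  [/\ ideal I, I <> [set 0]
    & forall J, ideal J -> J <> [set 0] -> I `&` J <> [set 0]].

End AlgebraNotions.

Arguments rank_one {R} A.
Arguments socle {R} A.

Definition minimal_elements (T : Type) (le : T -> T -> Prop) (S : set T) :
    set T :=
  [set m | S m /\ forall x, S x -> le x m -> x = m].

(* Main.v *)
Require Import Defs.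
From mathcomp Require Import all_boot all_order all_algebra.
From mathcomp Require Import complex.
From mathcomp Require Import boolp classical_sets reals topology normedtype.

Local Open Scope classical_set_scope.
Local Open Scope ring_scope.

(* A minimal left ideal is [L = A p] for a projection [p], and right
   multiplication by any element is zero or injective on [L]; in particular
   [p A p] is a division ring, which replaces [p A p = C p] throughout, so that
   Gelfand-Mazur is not needed.

   If [x <> 0] lies below a rank-one [u = u p], then [x = u d] with [d] in
   [p A p], and cancelling in [u d d* u* u d = u d u* u d] gives
   [d = d d* = d* = p].  Conversely, if [m <> 0], essentiality of the socle
   provides a [p] with [p m <> 0]; with [c] the inverse of [p m m* p] in
   [p A p], the rank-one element [m m* c m] lies below [m]. *)

Import GRing.Theory.

Section StarAlgebra.

Set Implicit Arguments.
Unset Strict Implicit.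

Context {R : realType} {A : unitalCStarAlgType R}.
Implicit Types (a b k m p u w x y z : A) (J L : set A).

Lemma star0 : star (0 : A) = 0.
Proof. by apply: (addrI (star (0 : A))); rewrite -starD !addr0. Qed.

Lemma starB a b : star (a - b) = star a - star b.
Proof. by apply: (addIr (star b)); rewrite -starD !subrK. Qed.

Lemma star_eq0 a : star a = 0 -> a = 0.
Proof. by move=> a0; rewrite -(starK a) a0 star0. Qed.

Lemma cnorm0 : cnorm (0 : A) = 0.
Proof.
by rewrite -(scale0r (0 : A)) cnormZ ComplexField.Normc.normc0 mul0r.
Qed.

Lemma starMl_eq0 a : star a * a = 0 -> a = 0.
Proof.
move=> aa0; apply: cnorm0_eq0; apply/eqP.
by rewrite -sqrf_eq0 -cnorm_star aa0 cnorm0.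
Qed.

Lemma starMr_eq0 a : a * star a = 0 -> a = 0.
Proof. by move=> aa0; apply/star_eq0/starMl_eq0; rewrite starK. Qed.

Lemma left_idealB L : left_ideal L -> forall x y, L x -> L y -> L (x - y).
Proof.
by move=> [_ LD LM] x y Lx Ly; apply: LD => //; rewrite -mulN1r; apply: LM.
Qed.

Lemma left_ideal_mulr L z : left_ideal L -> left_ideal [set y * z | y in L].
Proof.
move=> [L0 LD LM]; split; first by exists 0 => //; rewrite mul0r.
  by move=> _ _ [a La <-] [b Lb <-]; exists (a + b); [exact: LD|rewrite mulrDl].
by move=> a _ [b Lb <-]; exists (a * b); [exact: LM|rewrite mulrA].
Qed.

Lemma left_ideal_mulr_preim J z :
  left_ideal J -> left_ideal [set y | J (y * z)].
Proof.
move=> [J0 JD JM]; split => /=; first by rewrite mul0r.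
  by move=> x y Jx Jy; rewrite mulrDl; apply: JD.
by move=> a x Jx; rewrite -mulrA; apply: JM.
Qed.

Lemma left_idealI J L : left_ideal J -> left_ideal L -> left_ideal (J `&` L).
Proof.
move=> [J0 JD JM] [L0 LD LM]; split => //.
  by move=> x y [Jx Lx] [Jy Ly]; split; [exact: JD|exact: LD].
by move=> a x [Jx Lx]; split; [exact: JM|exact: LM].
Qed.

Lemma left_ideal0 : left_ideal [set (0 : A)].
Proof.
split=> // [x y -> ->|a x ->]; first by rewrite addr0.
by rewrite mulr0.
Qed.

(** The kernel of right multiplication by [z] on [L] is a left ideal missing [w], hence zero by
    minimality. *)
Lemma mulr_min_inj L z w : minimal_left_ideal L -> L w -> w * z <> 0 ->
  forall y, L y -> y * z = 0 -> y = 0.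
Proof.
move=> [Lid _ Lmin] Lw wz y Ly yz.
have Kid := left_idealI (left_ideal_mulr_preim z left_ideal0) Lid.
have [K0|KL] := Lmin _ Kid (@subIsetr _ _ _).
  by have : [set (0 : A)] y by rewrite -K0.
by have : ([set y | [set 0] (y * z)] `&` L) w by [rewrite KL]; case.
Qed.

Lemma min_generated L z y : minimal_left_ideal L -> L z -> z <> 0 ->
  L y -> exists a, y = a * z.
Proof.
move=> [Lid _ Lmin] Lz z0 Ly.
have Tid : left_ideal [set: A] by [].
have zL : [set a * z | a in setT] `<=` L.
  by move=> _ [a _ <-]; case: Lid => _ _; apply.
have [K0|KL] := Lmin _ (left_ideal_mulr z Tid) zL.
  have : [set a * z | a in setT] z by exists 1 => //; rewrite mul1r.
  by rewrite K0.
by move: Ly; rewrite -KL => -[a _ <-]; exists a.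
Qed.

Lemma minimal_left_ideal_mulr L z w : minimal_left_ideal L -> L w ->
  w * z <> 0 -> minimal_left_ideal [set y * z | y in L].
Proof.
move=> [Lid _ Lmin] Lw wz; split; first exact: left_ideal_mulr.
  by move=> L0; apply: wz; have : [set y * z | y in L] (w * z) by [exists w];
    rewrite L0.
move=> J Jid JL.
(* Minimality of [L] is applied to the preimage of [J] under right multiplication by [z]. *)
have Kid := left_idealI (left_ideal_mulr_preim z Jid) Lid.
have [K0|KL] := Lmin _ Kid (@subIsetr _ _ _); [left|right].
  apply/seteqP; split => [x Jx|_ ->]; last by case: Jid.
  have [y Ly yx] := JL _ Jx.
  have : ([set y | J (y * z)] `&` L) y by split=> //=; rewrite yx.
  by rewrite K0 -yx => ->; rewrite mul0r.
apply/seteqP; split => // _ [y Ly <-].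
by move: Ly; rewrite -KL => -[].
Qed.

(** With [h = u* u], the C*-identity gives [h h <> 0], so [h] can be cancelled on the right in [L],
    and [h h] generates [L]. Writing [h = a h h], the element [e = a h] satisfies [e h = h];
    cancelling [h] turns this into [y e = y] on [L] and [e* e = e]. *)
Lemma minimal_left_ideal_projection L u : minimal_left_ideal L -> L u ->
  u <> 0 -> exists p, [/\ L p, p <> 0, star p = p & forall y, L y -> y * p = y].
Proof.
move=> Lmin Lu u0; have [Lid _ _] := Lmin.
have LM a x : L x -> L (a * x) by case: Lid => _ _; apply.
pose h := star u * u.
have hs : star h = h by rewrite /h starM starK.
have h0 : h <> 0 by move=> /starMl_eq0.
have Lh : L h by exact: LM.
have hh : h * h <> 0 by rewrite -[X in X * _]hs => /starMl_eq0.
have inj y y' : L y -> L y' -> y * h = y' * h -> y = y'.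
  move=> Ly Ly' e; apply/subr0_eq.
  apply: (mulr_min_inj Lmin Lh hh); first exact: left_idealB.
  by rewrite mulrBl e subrr.
have [a ha] := min_generated Lmin (LM h h Lh) hh Lh.
pose e := a * h.
have Le : L e by exact: LM.
have eh : e * h = h by rewrite /e -mulrA -ha.
have ye y : L y -> y * e = y.
  by move=> Ly; apply: inj => //; [exact: LM|rewrite -mulrA eh].
have seh : star e * h = h by rewrite -{1}hs -starM ye // hs.
have ee : star e * e = e.
  by apply: inj => //; [exact: LM|rewrite -mulrA eh seh].
exists e; split => //; first by move=> e0; apply: h0; rewrite -eh e0 mul0r.
by rewrite -ee starM starK.
Qed.

Lemma corner_inverse L p k : minimal_left_ideal L -> L p -> star p = p ->
    (forall y, L y -> y * p = y) -> L k -> star k = k -> k <> 0 ->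
  exists c, [/\ c * k = p, star c = c & L c].
Proof.
move=> Lmin Lp ps Lright Lk ks k0; have [[_ _ LM] _ _] := Lmin.
have [a pa] := min_generated Lmin Lk k0 Lp.
have pp : p * p = p by exact: Lright.
have kp : p * k = k by rewrite -{1}ks -{1}ps -starM Lright.
(* Compressing [a] to the corner keeps [c k = p], because [p k = k]. Taking stars gives [k c* = p],
   so [c = c k c* = p c*], whose star is [c p = c]. *)
pose c := p * a * p.
have ck : c * k = p by rewrite /c -!mulrA kp -pa pp.
have cp : c * p = c by rewrite /c -!mulrA pp.
have kcs : k * star c = p by rewrite -{1}ks -starM ck ps.
exists c; split => //; last by rewrite /c; apply: LM.
have cE : c = p * star c by rewrite -ck -mulrA kcs cp.
by rewrite {2}cE -{1}ps -starM cp.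
Qed.

Lemma rank_one_diamond_minimal u x : rank_one A u -> x <> 0 ->
  diamond_le x u -> x = u.
Proof.
move=> [u0 [L Lmin Lu]] x0 [xu ux xxx].
have [[_ _ LM] _ _] := Lmin.
have [p [Lp p0 ps Lright]] := minimal_left_ideal_projection Lmin Lu u0.
have [|w _ uw] := xu x; first by exists 1; rewrite ?mulr1.
have [|v _ vu] := ux x; first by exists 1; rewrite ?mul1r.
rewrite /= in uw vu.
have Lx : L x by rewrite -vu; apply: LM.
have pp : p * p = p by exact: Lright.
have up : u * p = u by exact: Lright.
(* Since [u = u p] and [x = x p], the factor [w] in [x = u w] can be compressed to the corner. *)
pose d := p * w * p.
have xd : x = u * d by rewrite /d !mulrA up uw Lright.
have Ld : L d by exact: LM.
have sd : star d = p * star w * p by rewrite /d !starM ps mulrA.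
have Lsd : L (star d) by rewrite sd; apply: LM.
have d0 : d <> 0 by move=> d0; apply: x0; rewrite xd d0 mulr0.
have pd : p * d = d by rewrite /d !mulrA pp.
pose k := star u * u.
have k0 : k <> 0 by move=> /starMl_eq0.
have ks : star k = k by rewrite /k starM starK.
have Lk : L k by exact: LM.
have pk : p * k = k by rewrite -{1}ks -{1}ps -starM Lright.
have injd y : L y -> y * d = 0 -> y = 0.
  by apply: (mulr_min_inj Lmin Lp); rewrite pd.
have injk y : L y -> y * k = 0 -> y = 0.
  by apply: (mulr_min_inj Lmin Lp); rewrite pk.
have Ldd : L (d * star d - d).
  by apply: left_idealB => //; [case: Lmin|exact: LM].
(* Multiplied on the right by [k d], this is [x x* x = x u* x] for [x = u d]. *)
have udd : u * (d * star d - d) = 0.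
  apply: injk; first exact: LM.
  apply: injd; first exact: LM.
  move: xxx; rewrite xd starM !mulrBr !mulrBl /k !mulrA => ->.
  by rewrite subrr.
have dds : d * star d = star d.
  apply/subr0_eq/injk; first by apply: left_idealB => //; [case: Lmin|exact: LM].
  apply: star_eq0.
  rewrite starM ks starB starM starK /k -mulrA udd.
  by rewrite mulr0.
have sdd : star d = d by have := congr1 star dds; rewrite (starM d) starK dds.
have dp : d = p.
  apply/subr0_eq/injd; first by apply: left_idealB => //; case: Lmin.
  by rewrite mulrBl pd -{2}sdd dds sdd subrr.
by rewrite xd dp up.
Qed.

(** Otherwise [m] lies in the right annihilator [J] of the socle. This is a two-sided ideal, and any
    [y] in both [J] and the socle has [y y* y = 0], hence [y = 0], against essentiality. *)
Lemma essential_socle_mulr m : essential_ideal (socle A) -> m <> 0 ->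
  exists L u, [/\ minimal_left_ideal L, L u & u * m <> 0].
Proof.
move=> [[_ Sr] _ Sess] m0; apply: contrapT => none.
pose J := [set y | forall s, socle A s -> s * y = 0].
have Jid : ideal J.
  split; last by move=> a x Jx s Ss; rewrite mulrA Jx // mul0r.
  split=> [s _|x y Jx Jy s Ss|a x Jx s Ss].
  - by rewrite mulr0.
  - by rewrite mulrDr Jx // Jy // addr0.
  - by rewrite mulrA Jx //; apply: Sr.
have Jm : J m.
  move=> _ [n [f [fmin ->]]]; rewrite mulr_suml big1 // => i _.
  apply: contrapT => fm; have [L Lmin Lf] := fmin i.
  by apply: none; exists L, (f i).
apply: (Sess J Jid); first by move=> J0; apply: m0; move: Jm; rewrite J0.
apply/seteqP; split => [y [Sy Jy]|_ ->].
  have yyy : y * star y * y = 0 by apply: Jy; apply: Sr.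
  have yy : star (star y * y) * (star y * y) = 0.
    by rewrite starM starK -mulrA [y * _]mulrA yyy mulr0.
  exact/starMl_eq0/starMl_eq0.
split; last by case: Jid => -[].
by exists 0%N, (fun=> 0); split; [case|rewrite big_ord0].
Qed.

Lemma rank_one_below m : essential_ideal (socle A) -> m <> 0 ->
  exists x, rank_one A x /\ diamond_le x m.
Proof.
move=> hA m0.
have [L [u [Lmin Lu um]]] := essential_socle_mulr hA m0.
have [[_ _ LM] _ _] := Lmin.
have u0 : u <> 0 by move=> u0; apply: um; rewrite u0 mul0r.
have [p [Lp p0 ps Lright]] := minimal_left_ideal_projection Lmin Lu u0.
have pm : p * m <> 0.
  by move=> pm; apply: um; rewrite -(Lright _ Lu) -mulrA pm mulr0.
pose k := p * m * star (p * m).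
have ks : star k = k by rewrite /k starM starK.
have k0 : k <> 0 by move=> /starMr_eq0.
have kE : k = p * m * star m * p by rewrite /k starM ps !mulrA.
have Lk : L k by rewrite kE; apply: LM.
have [c [ck cs Lc]] := corner_inverse Lmin Lp ps Lright Lk ks k0.
have cp : c * p = c by exact: Lright.
have pc : p * c = c by rewrite -{1}cs -{1}ps -starM cp.
(* As [c = c p = p c], the left side is [c k c = p c]. *)
have cmmc : c * m * star m * c = c.
  by rewrite -[RHS]pc -ck kE !mulrA cp -[_ * p * c]mulrA pc.
pose x := m * star m * c * m.
(* The left side is [k c k]; this identity serves to show [x <> 0]. *)
have kx : p * x * star m * p = k.
  have -> : k = k * c * k by rewrite -mulrA ck Lright.
  by rewrite /x kE !mulrA -[_ * p * c]mulrA pc -[_ * c * p]mulrA cp.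
have x0 : x <> 0.
  by move=> x0; apply: k0; rewrite -kx x0 mulr0 !mul0r.
exists x; split.
  split => //; exists [set y * m | y in L].
    exact: minimal_left_ideal_mulr Lmin Lp pm.
  by exists (m * star m * c) => //; apply: LM.
split.
- by move=> _ [a _ <-]; exists (star m * c * m * a) => //; rewrite /x !mulrA.
- by move=> _ [a _ <-]; exists (a * (m * star m * c)) => //; rewrite /x !mulrA.
- rewrite /x !starM starK cs !mulrA.
  (* Collapsing [c m m* c] to [c] inside [x x* x] leaves [x m* x]. *)
  have ycmmc y : y * c * m * star m * c = y * c.
    by rewrite -[in RHS]cmmc !mulrA.
  by rewrite ycmmc.
Qed.

End StarAlgebra.

Theorem proposition2p6 (R : realType) (A : unitalCStarAlgType R)
    (hA : essential_ideal (socle A)) :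
  rank_one A = minimal_elements (@diamond_le R A) ([set: A] `\ 0).
Proof.
apply/seteqP; split => [u ru|m [[_ m0] mmin]].
  split; first by split=> //; case: ru.
  by move=> x [_ x0]; apply: rank_one_diamond_minimal.
have [x [rx xm]] := rank_one_below hA m0.
by rewrite -(mmin x) //; split=> //; case: rx.
Qed.
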